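(* Let $n \geq 3$ and let $C_n$ be the cycle on $n$ vertices. Then $C_n$ is not a geodesic Leech graph, except for $n = 3$ and $n = 4$; that is, $C_3$ and $C_4$ are geodesic Leech graphs, and $C_n$ is not a geodesic Leech graph for every $n \geq 5$.
   Context: All graphs are finite, simple and undirected. A geodesic path in a graph $G$ is a path with at least one edge which is a shortest path in $G$ between its two end vertices; paths are undirected (a path and its reversal are the same path). The geodesic path number $t_{gp}(G)$ is the total number of geodesic paths in $G$. For an edge labeling $f : E(G) \to \{1,2,3,\dots\}$, the weight of a path $P$ is $w(P) = \sum_{e \in E(P)} f(e)$. The labeling $f$ is a geodesic Leech labeling of $G$ if the set of weights of the $t_{gp}(G)$ geodesic paths in $G$ is $\{1,2,\dots,t_{gp}(G)\}$ (so each of these values is the weight of exactly one geodesic path). A graph which admits a geodesic Leech labeling is called a geodesic Leech graph. *)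

(* Defs.v *)
From HB Require Import structures.
From mathcomp Require Import all_boot.
Set Implicit Arguments.
Unset Strict Implicit.
Unset Printing Implicit Defensive.

Record sgraph := SGraph {
  vertex :> finType;
  adj : rel vertex;
  adj_sym : symmetric adj;
  adj_irr : irreflexive adj }.

(* An edge is the unordered pair of its ends, as a two-element vertex set. *)
Definition edges (G : sgraph) : {set {set G}} :=
  [set [set e.1; e.2] | e : G * G & adj e.1 e.2].

(* The sequence x :: p of pairwise distinct vertices is a path with size p
   edges, from x to last x p. *)
Definition simple_path (G : sgraph) (x : G) (p : seq G) : bool :=
  path (@adj G) x p && uniq (x :: p).

(* Bounding the length of the competitors q by #|G| loses nothing, as the
   vertices of a path are distinct. *)
Definition geodesic (G : sgraph) (x : G) (p : seq G) : bool :=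
  [&& simple_path x p, 0 < size p &
    [forall q : #|G|.-bseq G,
       simple_path x q && (last x q == last x p) ==> (size p <= size q)]].

Definition path_edges (G : sgraph) (x : G) (p : seq G) : {set {set G}} :=
  [set e in pairmap (fun u v => [set u; v]) x p].

(* A path with at least one edge is determined, up to reversal, by its edge
   set, so the undirected geodesic paths are represented by their edge sets. *)
Definition geodesic_paths (G : sgraph) : {set {set {set G}}} :=
  [set path_edges xp.1 xp.2 | xp : G * #|G|.-bseq G & geodesic xp.1 xp.2].

Definition t_gp (G : sgraph) : nat := #|geodesic_paths G|.

Definition path_weight (G : sgraph) (f : {set G} -> nat) (P : {set {set G}}) :
  nat := \sum_(e in P) f e.

(* The values of f outside edges G are irrelevant. *)
Definition geodesic_leech_labeling (G : sgraph) (f : {set G} -> nat) : Prop :=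
  (forall e, e \in edges G -> 0 < f e) /\
  (forall w : nat,
     (exists2 P, P \in geodesic_paths G & path_weight f P = w) <->
     1 <= w <= t_gp G).

Definition geodesic_leech_graph (G : sgraph) : Prop :=
  exists f : {set G} -> nat, geodesic_leech_labeling f.

(* ordS is the successor modulo n; the condition i != j only matters for the
   degenerate case n = 1, where ordS i = i. *)
Definition cycle_adj (n : nat) (i j : 'I_n) : bool :=
  (i != j) && ((j == ordS i) || (i == ordS j)).

Lemma cycle_adj_sym n : symmetric (@cycle_adj n).
Proof. by move=> i j; rewrite /cycle_adj eq_sym orbC. Qed.

Lemma cycle_adj_irr n : irreflexive (@cycle_adj n).
Proof. by move=> i; rewrite /cycle_adj eqxx. Qed.

Definition cycle_graph (n : nat) : sgraph :=
  SGraph (@cycle_adj_sym n) (@cycle_adj_irr n).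

(* Main.v *)
(* For n >= 3 the geodesic paths of C_n are the n * k arcs with 1 to k edges,
   k = n./2.  Let S be the sum of all labels.  The arcs with j edges have total
   weight j * S, so a Leech labeling satisfies S * k(k+1)/2 = 1 + ... + n * k,
   that is S * (k+1) = n * (n * k + 1).  Modulo k + 1 this forces k+1 | 2 for
   n odd and k+1 | 6 for n even, leaving only n = 10 beyond n = 4.

   For n = 10 a finite search applies: the smallest label still to be chosen is
   the smallest value which is not the weight of an arc all of whose labels are
   already chosen, so that only its position has to be guessed. *)

Require Import Defs.
From mathcomp Require Import all_boot ssralg zmodp zify.
Set Implicit Arguments.
Unset Strict Implicit.
Unset Printing Implicit Defensive.

(** * Labelings of the cycle as periodic sequences *)

Definition arc_weight (c : nat -> nat) i j := sumn [seq c t | t <- iota i j].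

Definition arc_weights n c :=
  [seq arc_weight c i j.+1 | i <- iota 0 n, j <- iota 0 n./2].

(** A labeling is held as an n-periodic function on the naturals, [c t] being the label of the edge
    from t to t + 1 modulo n; an arc that passes 0 is then still an interval. *)
Definition cyclic_leech n (c : nat -> nat) :=
  [/\ forall t, c (t %% n) = c t, forall t, 0 < c t &
      perm_eq (arc_weights n c) (iota 1 (n * n./2))].

Lemma eq_arc_weight c c' i j : c =1 c' -> arc_weight c i j = arc_weight c' i j.
Proof. by move=> cc; rewrite /arc_weight (eq_map cc). Qed.

Lemma arc_weightE c i j : arc_weight c i j = \sum_(i <= t < i + j) c t.
Proof. by rewrite /arc_weight sumnE big_map /index_iota addKn. Qed.

Lemma arc_weight_modn n c i j : (forall t, c (t %% n) = c t) ->
  arc_weight c (i %% n) j = arc_weight c i j.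
Proof.
move=> cn; rewrite /arc_weight -[i %% n]addn0 -[i in RHS]addn0 !iotaDl -!map_comp.
by congr sumn; apply: eq_map => t /=; rewrite -cn modnDml cn.
Qed.

Lemma leq_label_arc_weight c i j t : t < j -> c (i + t) <= arc_weight c i j.
Proof.
move=> tj; rewrite arc_weightE (bigD1_seq (i + t)) ?iota_uniq ?leq_addr //=.
by rewrite mem_index_iota leq_addr ltn_add2l.
Qed.

Lemma perm_iota_addn_modn n p : 0 < n ->
  perm_eq [seq (i + p) %% n | i <- iota 0 n] (iota 0 n).
Proof.
move=> n0; set s := map _ _.
have us : uniq s.
  rewrite map_inj_in_uniq ?iota_uniq // => i j; rewrite !mem_iota !add0n /=.
  by move=> ilt jlt /eqP; rewrite eqn_modDr !modn_small // => /eqP.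
have sub : {subset s <= iota 0 n}.
  by move=> _ /mapP[i _ ->]; rewrite mem_iota /= add0n ltn_mod.
apply: (uniq_perm us (iota_uniq _ _)).
by have [] := uniq_min_size us sub; rewrite ?size_map ?size_iota.
Qed.

(** Lengthening all n arcs by one edge adds each label exactly once, since [i + j] runs through all
    residues modulo n. *)
Lemma sum_arc n c j : 0 < n -> (forall t, c (t %% n) = c t) ->
  \sum_(0 <= i < n) arc_weight c i j = j * \sum_(0 <= i < n) c i.
Proof.
move=> n0 cn; elim: j => [|j IH].
  by rewrite mul0n big1 // => i _; rewrite arc_weightE addn0 big_geq.
transitivity (\sum_(0 <= i < n) (arc_weight c i j + c (i + j))).
  by apply: eq_bigr => i _; rewrite !arc_weightE addnS big_nat_recr ?leq_addr.
rewrite big_split /= IH mulSn addnC; congr (_ + _).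
have <- : \sum_(t <- [seq (i + j) %% n | i <- iota 0 n]) c t = \sum_(0 <= i < n) c i.
  by rewrite /index_iota subn0; apply/perm_big/perm_iota_addn_modn.
by rewrite big_map /index_iota subn0; apply: eq_bigr => i _; rewrite cn.
Qed.

(** Twice the total weight of all arcs is counted by number of edges and by value, and the common
    factor k is cancelled. Doubling avoids dividing triangular numbers by 2. *)
Lemma label_sum n c : 0 < n -> 0 < n./2 -> cyclic_leech n c ->
  (\sum_(0 <= i < n) c i) * (n./2).+1 = n * (n * n./2).+1.
Proof.
move=> n0 k0 [cn _ cw]; set S := \sum_(_ <= _ < _) _; set k := n./2.
have gauss m : \sum_(0 <= j < m) j.+1 * 2 = m * m.+1.
  elim: m => [|m IH]; first by rewrite big_geq.
  by rewrite big_nat_recr //= IH; lia.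
have dbl m : \sum_(w <- iota 1 m) w * 2 = m * m.+1.
  by rewrite -gauss -[1]addn0 iotaDl big_map /index_iota subn0.
have := dbl (n * k); rewrite -(perm_big _ cw) /= big_allpairs_dep.
rewrite -!/(index_iota 0 n) exchange_big /=.
under eq_bigr => j _ do rewrite -big_distrl /=.
have E (j : nat) : \sum_(i <- iota 0 n) arc_weight c i j.+1 = j.+1 * S.
  by rewrite -sum_arc // /index_iota subn0.
under eq_bigr => j _ do rewrite E mulnAC.
rewrite -big_distrl /=.
have -> : \sum_(j <- iota 0 k) j.+1 * 2 = k * k.+1.
  by rewrite -gauss /index_iota subn0.
rewrite -/k => H; apply/eqP; rewrite -(eqn_pmul2l k0); apply/eqP.
by rewrite [S * _]mulnC mulnA H mulnA [k * n]mulnC.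
Qed.

Lemma cyclic_leech_order n c : 5 <= n -> cyclic_leech n c -> n = 10.
Proof.
move=> n5 /label_sum H; have {H} := H ltac:(lia) ltac:(lia).
set S := \sum_(_ <= _ < _) _; set k := n./2 => E.
have k2 : 2 <= k by rewrite /k; lia.
have nE : n = odd n + k * 2 by rewrite muln2 odd_double_half.
case: (odd n) nE => /= nE.
  (* For n = 2k + 1 the right-hand side is -2 modulo k + 1, as k = -1; but k + 1 is at least 3. *)
  have /dvdn_leq : k.+1 %| 2.
    rewrite -(@dvdn_addr (S * k.+1)) ?dvdn_mull // E.
    have -> : n * (n * k).+1 + 2 = k.+1 * (4 * k * k + 3) by rewrite nE; nia.
    by rewrite dvdn_mulr.
  by lia.
have k3 : 3 <= k by lia.
(* For n = 2k the right-hand side is -6 modulo k + 1, and k = 5 is the only k >= 3 with k + 1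
   dividing 6. The cofactor subtracts last, so that truncated subtraction is exact. *)
have d6 : k.+1 %| 6.
  rewrite -(@dvdn_addr (S * k.+1)) ?dvdn_mull // E.
  have -> : n * (n * k).+1 + 6 = k.+1 * (4 * k * k + 6 - 4 * k) by rewrite nE; nia.
  by rewrite dvdn_mulr.
have := @dvdn_leq _ 6 isT d6.
by case: (k) k3 d6 nE => [|[|[|[|[|[|k']]]]]] //; lia.
Qed.

(** * The search for n = 10 *)

(* In [s] the value [0] stands for a label still to be chosen. *)
Definition known_weights n s :=
  flatten [seq let r := take n./2 (rot i s) in
               scanl addn 0 (take (index 0 r) r) | i <- iota 0 n].

(* [u] flags the values already taken; the default [true] of [nth] also rules
   out the values beyond the length of [u]. *)
Fixpoint mark ws (u : bitseq) :=
  if ws is w :: ws' then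
    if nth true u w then None else mark ws' (set_nth true u w true)
  else Some u.

(* Conditionals replace boolean connectives since call-by-value evaluation
   would explore the discarded branches of the latter. *)
Fixpoint completable n d s :=
  if mark (known_weights n s) (true :: nseq (n * n./2) false) is Some u then
    if d is d'.+1 then
      let w := find negb u in
      has (fun p => if nth 0 s p is 0 then completable n d' (set_nth 0 s p w)
                    else false) (iota 0 n)
    else true
  else false.

(** The exhaustive search, by computation: label 1 stands at position 0 and nine labels remain. *)
Lemma completable10 : completable 10 9 (1 :: nseq 9 0) = false.
Proof. by vm_cast_no_check (erefl false). Qed.

Lemma markP ws u : uniq ws -> (forall w, w \in ws -> nth true u w = false) ->
  exists2 u', mark ws u = Some u' &
    forall w, nth true u' w = nth true u w || (w \in ws).
Proof.
elim: ws u => [|w ws IH] u /=; first by exists u => // w; rewrite orbF.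
move=> /andP[wws uws] uF; rewrite uF ?mem_head //.
have [//|x xws|u' -> u'E] := IH (set_nth true u w true).
  rewrite nth_set_nth /=; case: eqP xws wws => [->->//|_ xws _].
  by rewrite uF // inE xws orbT.
exists u' => // x; rewrite u'E nth_set_nth /= inE.
by case: eqP => // _; rewrite orbT.
Qed.

(** Matches the prefix sums computed by the search with the arcs starting at [i]. *)
Lemma scanl_arc_weight c i m :
  scanl addn 0 [seq c t | t <- iota i m] =
  [seq arc_weight c i j.+1 | j <- iota 0 m].
Proof.
apply: (@eq_from_nth _ 0); rewrite size_scanl !size_map !size_iota // => j jm.
rewrite nth_scanl ?size_map ?size_iota // (nth_map 0) ?size_iota // nth_iota //.
rewrite add0n /arc_weight -map_take take_iota (minn_idPl jm).
by rewrite sumnE (foldl_idx) // .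
Qed.

Lemma uniq_map_inj (T U : eqType) (f : T -> U) s :
  uniq (map f s) -> {in s &, injective f}.
Proof.
move=> u x y xs ys e; rewrite -(nth_index x xs) -(nth_index x ys).
congr nth; apply/eqP; rewrite -(nth_uniq (f x) _ _ u) ?size_map ?index_mem //.
by rewrite !(nth_map x) ?index_mem // !nth_index // e.
Qed.

(** * Completeness of the search: it never discards a genuine Leech labeling *)

Section Completion.
Variables (n : nat) (c : nat -> nat).
Hypothesis leech_c : cyclic_leech n c.

Let c_mod t : c (t %% n) = c t. Proof. by have [] := leech_c. Qed.
Let c_gt0 t : 0 < c t. Proof. by have [] := leech_c. Qed.

(** To be read as: the full labeling [c] extends the partial labeling [s]. *)
Definition extends s :=
  size s = n /\ forall t, t < n -> nth 0 s t = 0 \/ nth 0 s t = c t.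

(** The arcs from [i] whose labels are all chosen are those with at most this many edges. *)
Definition assigned s i := index 0 (take n./2 (rot i s)).

Lemma nth_window s i j : size s = n -> i < n -> j < n./2 ->
  nth 0 (take n./2 (rot i s)) j = nth 0 s ((i + j) %% n).
Proof.
move=> sn iN jk; rewrite nth_take // /rot nth_cat size_drop sn nth_drop.
case: ltnP => h; first by rewrite modn_small //; lia.
rewrite nth_take; last by lia.
have -> : i + j = (j - (n - i)) + n by lia.
by rewrite modnDr modn_small //; lia.
Qed.

Lemma assigned_le s i : size s = n -> assigned s i <= n./2.
Proof.
move=> sn; apply: leq_trans (index_size _ _) _.
by rewrite size_take size_rot sn; case: ifP => // /negbT; rewrite -leqNgt.
Qed.

Lemma window_known s i : extends s -> i < n ->
  take (assigned s i) (take n./2 (rot i s)) =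
  [seq c t | t <- iota i (assigned s i)].
Proof.
move=> [sn sc] iN; have mk := assigned_le i sn.
have sz : size (take n./2 (rot i s)) = n./2.
  by rewrite size_takel // size_rot sn; lia.
apply: (@eq_from_nth _ 0); rewrite size_takel ?sz // ?size_map ?size_iota // => j jm.
rewrite nth_take // (nth_map 0) ?size_iota // nth_iota //.
have jk := leq_trans jm mk.
have /negbT := before_find 0 jm; rewrite /= nth_window // => nz.
have n0 : 0 < n by lia.
have [z|->] := sc ((i + j) %% n) (ltn_pmod _ n0); last exact: c_mod.
by rewrite z in nz.
Qed.

Lemma known_weightsE s : extends s ->
  known_weights n s =
  [seq arc_weight c i j.+1 | i <- iota 0 n, j <- iota 0 (assigned s i)].
Proof.
move=> es; congr flatten; apply/eq_in_map => i; rewrite mem_iota => /= iN.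
by rewrite -scanl_arc_weight -window_known.
Qed.

Lemma arc_weight_inj i j i' j' :
  i < n -> i' < n -> j < n./2 -> j' < n./2 ->
  arc_weight c i j.+1 = arc_weight c i' j'.+1 -> i = i' /\ j = j'.
Proof.
move=> iN i'N jk j'k E.
have [_ _ cw] := leech_c.
have: uniq (arc_weights n c) by rewrite (perm_uniq cw) iota_uniq.
(* Once the weights are the image of the list of all index pairs, absence of duplicates becomes
   injectivity on pairs. *)
rewrite -[arc_weights n c](map_allpairs (fun ij => arc_weight c ij.1 ij.2.+1) pair).
have T x y : x < n -> y < n./2 ->
    (x, y) \in [seq (x, y) | x <- iota 0 n, y <- iota 0 n./2].
  by move=> xn yk; apply: allpairs_f; rewrite mem_iota.
by move=> /uniq_map_inj inj; case: (inj _ _ (T i j iN jk) (T i' j' i'N j'k) E).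
Qed.

Lemma mem_arc_weights w :
  reflect (exists ij, [/\ ij.1 < n, ij.2 < n./2 & w = arc_weight c ij.1 ij.2.+1])
          (0 < w <= n * n./2).
Proof.
have [_ _ cw] := leech_c.
have -> : (0 < w <= n * n./2) = (w \in arc_weights n c).
  by rewrite (perm_mem cw) mem_iota add1n.
apply: (iffP allpairsP) => -[[i j] /=].
  by rewrite !mem_iota => -[iN jk ->]; exists (i, j).
by move=> [iN jk ->]; exists (i, j); rewrite !mem_iota.
Qed.

Lemma known_weights_uniq s : extends s -> uniq (known_weights n s).
Proof.
move=> es; have [sn _] := es.
rewrite known_weightsE //; apply: allpairs_uniq_dep; rewrite ?iota_uniq //.
  by move=> i _; apply: iota_uniq.
move=> _ _ /allpairsPdep[i [j [iI jI ->]]] /allpairsPdep[i' [j' [iI' jI' ->]]] /= E.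
move: iI jI iI' jI'; rewrite !mem_iota !add0n /= => iN ja iN' ja'.
by have [|||| -> ->] := arc_weight_inj _ _ _ _ E;
  rewrite ?(leq_trans ja (assigned_le i sn)) ?(leq_trans ja' (assigned_le i' sn)).
Qed.

Lemma mem_known_weights s w : extends s -> w \in known_weights n s ->
  exists ij, [/\ ij.1 < n, ij.2 < assigned s ij.1 & w = arc_weight c ij.1 ij.2.+1].
Proof.
move=> es; rewrite known_weightsE // => /allpairsPdep[i [j []]].
by rewrite !mem_iota => iN ja ->; exists (i, j).
Qed.

Lemma mark_known_weights s : extends s ->
  exists2 u, mark (known_weights n s) (true :: nseq (n * n./2) false) = Some u &
    forall w, nth true u w =
      ~~ (0 < w <= n * n./2) || (w \in known_weights n s).
Proof.
move=> es; have [sn _] := es.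
(* Flag 0 is set from the start because 0 is not a weight, and the default [true] covers the values
   above n * k. *)
have nthE w : nth true (true :: nseq (n * n./2) false) w = ~~ (0 < w <= n * n./2).
  by case: w => //= w; rewrite nth_nseq; case: ltnP.
have [w /(mem_known_weights es)[[i j] /= [iN ja ->]]|u uE uP] :=
    markP (u := true :: nseq (n * n./2) false) (known_weights_uniq es).
  rewrite nthE; apply/negbF/mem_arc_weights; exists (i, j); split=> //.
  exact: leq_trans ja (assigned_le i sn).
by exists u => // w; rewrite uP nthE.
Qed.

Lemma arc_weight_single t : arc_weight c t 1 = c t.
Proof. by rewrite /arc_weight /= addn0. Qed.

(** The label is the weight of a one-edge arc; by injectivity of weights no other arc can supply it,
    and that arc itself is not fully labeled. *)
Lemma unassigned_label_unknown s p : 0 < n./2 -> extends s -> p < n ->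
  nth 0 s p = 0 -> c p \notin known_weights n s.
Proof.
move=> k0 es pn sp; have [sn _] := es.
apply/negP => /(mem_known_weights es)[[i j] /= [iN ja]].
have jk := leq_trans ja (assigned_le i sn).
rewrite -arc_weight_single => /arc_weight_inj[] // ? ?; subst i j.
have := before_find 0 ja; rewrite /= nth_window // addn0 modn_small //.
by rewrite sp.
Qed.

(** An arc weighs at least as much as each of its labels, so an arc lighter than every missing label
    contains none of them. *)
Lemma small_weight_known s v w : extends s ->
  (forall p, p < n -> nth 0 s p = 0 -> v <= c p) ->
  0 < w <= n * n./2 -> w < v -> w \in known_weights n s.
Proof.
move=> es vmin /mem_arc_weights[[i j] /= [iN jk ->]] wv; have [sn _] := es.
have n0 : 0 < n by lia.
rewrite known_weightsE //.
apply: (@allpairs_f_dep _ _ _ (fun i j => arc_weight c i j.+1)).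
  by rewrite mem_iota.
rewrite mem_iota /= add0n ltnNge; apply/negP => aj.
have ak := leq_ltn_trans aj jk.
have z : nth 0 (take n./2 (rot i s)) (assigned s i) = 0.
  apply: nth_index; rewrite -index_mem size_takel // size_rot sn; lia.
rewrite nth_window // in z.
have := vmin _ (ltn_pmod _ n0) z; rewrite c_mod leqNgt => /negP[].
exact: leq_ltn_trans (@leq_label_arc_weight c i j.+1 _ aj) wv.
Qed.

Lemma find_negb_eq (u : bitseq) v : nth true u v = false ->
  (forall w, w < v -> nth true u w) -> find negb u = v.
Proof.
move=> uv lt_v.
have vs : v < size u by rewrite ltnNge; apply: contraFN uv => /(nth_default true)->.
have hasu : has negb u.
  by apply/(has_nthP true); exists v => //; rewrite uv.
case: (ltngtP (find negb u) v) => // [/lt_v | /(before_find true)].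
  by have := nth_find true hasu => /negbTE->.
by rewrite uv.
Qed.

(** By induction on the number of labels to place: the branch that puts the smallest missing label
    of [c] at its true position stays compatible with [c]. *)
Lemma completable_of_extends d s : 0 < n./2 ->
  extends s -> d <= count_mem 0 s -> completable n d s.
Proof.
move=> k0; elim: d s => [|d IH] s es ds /=.
  by have [u -> _] := mark_known_weights es.
have [u -> uE] := mark_known_weights es; have [sn sc] := es.
have [p0 p0n sp0] : exists2 p, p < n & nth 0 s p = 0.
  have : has (pred1 0) s by rewrite has_count; apply: leq_trans ds.
  by move=> /(has_nthP 0)[p]; rewrite sn => pn /eqP; exists p.
have [p /eqP sp pmin] := @arg_minnP 'I_n (Ordinal p0n)
  (fun p => nth 0 s p == 0) (fun p => c p) (introT eqP sp0).
have pn := ltn_ord p.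
(* The smallest missing label is the first unflagged value: it is not yet a known weight, while all
   smaller values are. *)
have wE : find negb u = c p.
  apply: find_negb_eq => [|w wp].
    rewrite uE (negbTE (unassigned_label_unknown k0 es pn sp)) orbF.
    apply/negbF/mem_arc_weights; exists (val p, 0).
    by rewrite arc_weight_single.
  rewrite uE; case: (boolP (_ && _)) => //= wr.
  apply: small_weight_known es _ wr wp => q qn /eqP sq.
  exact: (pmin (Ordinal qn)).
rewrite wE; apply/hasP; exists (val p); first by rewrite mem_iota.
rewrite /= sp; apply: IH.
  split=> [|t tn]; first by rewrite size_set_nth sn; apply/maxn_idPr.
  by rewrite nth_set_nth /=; case: eqP => [->|_]; [right | apply: sc].
rewrite count_set_nth_ltn ?sn // sp /=.
(* A label is positive, so the filled entry no longer counts as missing. *)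
have := c_gt0 p; case: (c p) => // m _.
by rewrite addn0 subn1 -ltnS prednK // (leq_trans _ ds).
Qed.

End Completion.

(** Rotation permutes the arcs with a given number of edges; it serves to bring the label 1 to
    position 0. *)
Lemma rotate_leech n c p : 0 < n -> cyclic_leech n c ->
  cyclic_leech n (fun t => c (t + p)).
Proof.
move=> n0 [cn c0 cw]; split=> // [t|].
  by rewrite -cn modnDml cn.
rewrite -(permPr cw) /arc_weights.
have -> : [seq arc_weight (fun t => c (t + p)) i j.+1 | i <- iota 0 n, j <- iota 0 n./2]
  = [seq arc_weight c i j.+1 | i <- [seq (i + p) %% n | i <- iota 0 n],
                               j <- iota 0 n./2].
  rewrite /allpairs_dep -map_comp; congr flatten; apply: eq_map => i /=.
  apply: eq_map => j; rewrite arc_weight_modn // /arc_weight addnC iotaDl.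
  by rewrite -map_comp; congr sumn; apply: eq_map => t /=; rewrite addnC.
by apply: perm_allpairs_dep => //; apply: perm_iota_addn_modn.
Qed.

Lemma no_cyclic_leech10 c : ~ cyclic_leech 10 c.
Proof.
move=> lc.
(* Some arc has weight 1, and its first label is positive and at most 1. *)
have [p cp] : exists p, c p = 1.
  have /(mem_arc_weights lc)[[i j] /= [_ _ E]] : 0 < 1 <= 10 * 10./2 by [].
  exists (i + 0); have [_ c0 _] := lc.
  by have := c0 (i + 0); have := leq_label_arc_weight c i (ltn0Sn j); lia.
have /completable_of_extends := @rotate_leech 10 c p isT lc.
move=> /(_ 9 (1 :: nseq 9 0)); rewrite completable10 => H.
by suff : false by []; apply: H => //; split=> // -[|t] tn;
  [right | left; apply: etrans (nth_nseq 0 9 0 t) (if_same _ _)].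
Qed.

(** * Geodesic paths of the cycle *)

Import GRing.Theory.

Section CycleGeodesics.
Variable N : nat.
Local Notation n := N.+3.
Local Notation V := 'I_N.+3.
Local Notation Cn := (cycle_graph N.+3).
Implicit Types (x y i d : V) (m t : nat).
Local Open Scope ring_scope.

Lemma val_ord_natr m : (m%:R : V) = (m %% n)%N :> nat.
Proof. by rewrite Zp_nat. Qed.

(** The vertices form the ring of integers modulo n, where a step along the cycle adds [1] or
    [-1]. *)
Lemma ordSE x : ordS x = x + 1.
Proof. by apply: val_inj; rewrite /= modnDmr addn1. Qed.

Lemma cycle_adjE x y : cycle_adj x y = (y == x + 1) || (x == y + 1).
Proof.
rewrite /cycle_adj !ordSE; case: eqP => //= <-.
by rewrite -[X in X == _]addr0 (inj_eq (addrI x)).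
Qed.

(** * Simple paths of the cycle as rays *)

Definition direction d := (d == 1) || (d == -1).

Lemma mulrn_direction_eq0 d m : direction d -> (d *+ m == 0) = (n %| m)%N.
Proof.
have one : ((1 : V) *+ m == 0) = (n %| m)%N by rewrite -val_eqE /= val_ord_natr.
by case/orP=> /eqP-> //; rewrite mulNrn oppr_eq0.
Qed.

Lemma mulrn_direction_inj d m m' : direction d -> (m < n)%N -> (m' < n)%N ->
  d *+ m = d *+ m' -> m = m'.
Proof.
move=> dd; wlog le : m m' / (m <= m')%N.
  by move=> W mn m'n E; case: (leqP m m') => [/W|/ltnW /W h]; [exact | rewrite h].
move=> mn m'n /eqP; rewrite eq_sym -subr_eq0 -mulrnBr // mulrn_direction_eq0 //.
by rewrite /dvdn modn_small //; lia.
Qed.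

(** Starts at offset 1, since a path is given by its first vertex and the sequence of the others. *)
Definition ray x d m : seq Cn := [seq x + d *+ t | t <- iota 1 m].

Lemma last_ray x d m : last x (ray x d m) = x + d *+ m.
Proof.
have last_iota k : last k (iota k.+1 m) = (k + m)%N.
  by elim: m k => [|m IH] k /=; rewrite ?addn0 // IH addnS.
by rewrite -{1}[x]addr0 -[0](mulr0n d) (last_map (fun t => x + d *+ t)) last_iota.
Qed.

Lemma simple_ray x d m : direction d -> (m < n)%N -> simple_path (G := Cn) x (ray x d m).
Proof.
move=> dd mn; apply/andP; split.
  have: forall k, path (@adj Cn) (x + d *+ k) [seq x + d *+ t | t <- iota k.+1 m].
    elim: {mn} m => //= m IH k; rewrite IH andbT cycle_adjE mulrS.
    by case/orP: dd => /eqP->; rewrite addrCA addrC ?eqxx // subrK eqxx orbT.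
  by move=> /(_ 0%N); rewrite mulr0n addr0.
have -> : x :: ray x d m = [seq x + d *+ t | t <- iota 0 m.+1].
  by rewrite /= mulr0n addr0.
rewrite map_inj_in_uniq ?iota_uniq // => t t'; rewrite !mem_iota !add0n /= => tm t'm.
by move=> /addrI /mulrn_direction_inj; apply=> //; exact: leq_trans mn.
Qed.

(** At each vertex the only alternative to going on in direction [d] is to return to the previous
    vertex, which distinctness forbids. *)
Lemma straight_path x d (p : seq Cn) : direction d ->
  path (@adj Cn) (x + d) p -> uniq (x :: x + d :: p) ->
  p = ray (x + d) d (size p).
Proof.
move=> dd; elim: p x => // z p IH x /andP[adj_z pz] u.
have zE : z = x + d + d.
  move: adj_z; rewrite [adj _ _]cycle_adjE.
  have zx : z != x by apply: contraTneq u => ->; rewrite /= !inE eqxx orbT.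
  case/orP: dd => /eqP-> /orP[] /eqP E //.
    by move/addIr: E zx => ->; rewrite eqxx.
    by move: zx; rewrite E subrK eqxx.
  by rewrite E addrK.
rewrite zE in pz u *; rewrite /ray /= mulr1n; congr (_ :: _).
rewrite [LHS](IH (x + d)) //; last by case/andP: u.
rewrite /ray -[2%N]addn1 iotaDl -map_comp; apply: eq_map => t /=.
by rewrite mulrS addrA.
Qed.

Lemma simple_path_ray x (p : seq Cn) : simple_path (x : Cn) p ->
  exists d m, [/\ direction d, (m < n)%N & p = ray x d m].
Proof.
move=> /andP[pp up].
have sz : (size p < n)%N.
  have := uniq_leq_size up (s2 := enum V) (fun y _ => mem_enum V y).
  by rewrite size_enum_ord.
case: p pp up sz => [_ _ _|y p /= /andP[xy py] up sz].
  by exists 1, 0%N; rewrite /direction eqxx.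
have [d dd yE] : exists2 d, direction d & y = x + d.
  move: xy; rewrite cycle_adjE => /orP[] /eqP E.
    by exists 1; rewrite // /direction eqxx.
  by exists (-1); rewrite /direction ?eqxx ?orbT // E addrK.
exists d, (size p).+1; split=> //; rewrite yE in py up *.
rewrite [in LHS](straight_path dd py up) /ray /= mulr1n; congr (_ :: _).
rewrite -[2%N]addn1 iotaDl -map_comp; apply: eq_map => t /=.
by rewrite mulrS addrA.
Qed.

(** The only other simple path between the same ends goes round the opposite way, with n - m
    edges. *)
Lemma geodesic_ray x d m : direction d -> (m < n)%N ->
  geodesic (G := Cn) x (ray x d m) = (0 < m <= n./2)%N.
Proof.
move=> dd mn; rewrite /geodesic simple_ray // size_map size_iota /=.
case: (posnP m) => //= m0.
have dN : direction (- d).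
  by move: dd; rewrite /direction eqr_opp eqr_oppLR orbC.
have cardCn : #|Cn| = n by apply: card_ord.
apply/forallP/idP => [|mk q].
  have sz : (size (ray x (- d) (n - m)) <= #|Cn|)%N.
    by rewrite cardCn size_map size_iota leq_subr.
  move=> /(_ (Bseq sz)) /implyP /=; rewrite size_map size_iota => H.
  suff : (m <= n - m)%N by lia.
  apply: H; rewrite simple_ray //; last by lia.
  rewrite !last_ray; apply/eqP; congr (_ + _); apply/eqP.
  rewrite -subr_eq0 mulNrn -opprD oppr_eq0 -mulrnDr subnK ?(ltnW mn) //.
  by rewrite mulrn_direction_eq0.
apply/implyP => /andP[/simple_path_ray[d' [m' [dd' m'n ->]]]].
rewrite !last_ray size_map size_iota => /eqP/addrI E.
have [dE|dE] : d' = d \/ d' = - d.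
  by case/orP: dd dd' => /eqP-> /orP[] /eqP->; rewrite ?opprK; auto.
  by rewrite dE in E; rewrite (mulrn_direction_inj dd m'n mn E).
(* Two opposite rays with the same ends go once round the cycle: m + m' is a positive multiple of n,
   and m is at most half of n. *)
have : (n %| m + m')%N.
  rewrite -(mulrn_direction_eq0 _ dd) mulrnDr -E dE mulNrn addNr.
  by rewrite eqxx.
by move=> /dvdn_leq; lia.
Qed.

(** * Geodesics as edge sets of forward arcs *)

Definition cycle_edge x : {set V} := [set x; x + 1].

Definition cycle_arc x m : {set {set V}} :=
  [set e in [seq cycle_edge (x + t%:R) | t <- iota 0 m]].

Lemma path_edges_ray x d m : path_edges (G := Cn) x (ray x d m) =
  [set e in [seq [set x + d *+ t; x + d *+ t.+1] | t <- iota 0 m]].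
Proof.
have pairmapE k :
    pairmap (fun u v : Cn => [set u; v]) (x + d *+ k) [seq x + d *+ t | t <- iota k.+1 m]
    = [seq [set x + d *+ t; x + d *+ t.+1] | t <- iota k m].
  by elim: m k => //= m IH k; rewrite IH.
by have := pairmapE 0%N; rewrite mulr0n addr0 /path_edges => ->.
Qed.

Lemma path_edges_ray1 x m : path_edges (G := Cn) x (ray x 1 m) = cycle_arc x m.
Proof.
rewrite path_edges_ray (@eq_map _ _ _ (fun t => cycle_edge (x + t%:R))) // => t.
by rewrite /cycle_edge -addrA mulrSr.
Qed.

(** A backward ray is the forward arc from its last vertex, with the edges in reverse order: edge
    [t] becomes edge [m - t.+1]. *)
Lemma path_edges_rayN1 x m :
  path_edges (G := Cn) x (ray x (-1) m) = cycle_arc (x - m%:R) m.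
Proof.
rewrite path_edges_ray; apply/setP => e; rewrite !inE.
have E t : (t < m)%N ->
    [set x + -1 *+ t; x + -1 *+ t.+1] = cycle_edge (x - m%:R + (m - t.+1)%:R).
  move=> tm; rewrite /cycle_edge setUC -!addrA; congr [set _; _]; congr (x + _).
    by rewrite natrB // addKr mulNrn.
  by rewrite -mulrSr subnSK // natrB ?(ltnW tm) // addKr mulNrn.
apply/mapP/mapP => -[t]; rewrite mem_iota add0n /= => tm ->.
  by exists (m - t.+1)%N; rewrite ?mem_iota ?E //= ltn_subrL; lia.
exists (m - t.+1)%N; first by rewrite mem_iota; lia.
by rewrite E; [rewrite subnSK // subKn // ltnW | lia].
Qed.

Lemma geodesic_pathsE :
  geodesic_paths Cn = [set cycle_arc ij.1 ij.2.+1 | ij : V * 'I_(n./2)].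
Proof.
have cardCn : #|Cn| = n by apply: card_ord.
apply/setP => P; apply/imsetP/imsetP => [[[x p]]|[[i j] _ ->]].
  rewrite inE => /= g ->.
  have [d [m [dd mn pE]]] := simple_path_ray (proj1 (andP g)).
  rewrite pE geodesic_ray // in g.
  case: m mn pE g => // m mn pE mk.
  case/orP: dd pE => /eqP-> ->.
    by exists (x, Ordinal mk); rewrite ?path_edges_ray1.
  by exists (x - m.+1%:R, Ordinal mk); rewrite ?path_edges_rayN1.
have jn : (j.+1 < n)%N by have := ltn_ord j; lia.
have sz : (size (ray i 1%R j.+1) <= #|Cn|)%N.
  by rewrite cardCn size_map size_iota ltnW.
exists (i, Bseq sz); last by rewrite /= path_edges_ray1.
by rewrite inE /= geodesic_ray //= /direction eqxx.
Qed.

(** Two distinct vertices giving the same edge would be successors of each other, so 2 = 0 modulo n,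
    which n >= 3 excludes. *)
Lemma cycle_edge_inj : injective cycle_edge.
Proof.
move=> x y E.
have : x \in cycle_edge y by rewrite -E !inE eqxx.
have : y \in cycle_edge x by rewrite E !inE eqxx.
rewrite !inE => /orP[/eqP->//|/eqP yE] /orP[/eqP//|/eqP xE].
have /eqP : (x + 1 *+ 2) = x + 1 *+ 0 by rewrite mulr2n addrA -yE -xE mulr0n addr0.
by rewrite (inj_eq (addrI x)) mulr0n mulrn_direction_eq0 // /direction eqxx.
Qed.

Lemma mem_cycle_arc x y m : (m <= n)%N ->
  (cycle_edge y \in cycle_arc x m) = ((y - x)%R < m)%N.
Proof.
move=> mn; rewrite inE; apply/mapP/idP => [[t]|yx].
  rewrite mem_iota leq0n add0n andTb => tm /cycle_edge_inj->.
  by rewrite addrAC addrN add0r val_ord_natr modn_small // (leq_trans tm).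
exists ((y - x)%R : nat); first by rewrite mem_iota.
by congr cycle_edge; rewrite natr_Zp addrC subrK.
Qed.

(** A nonempty arc that is not the whole cycle has exactly one edge whose predecessor lies outside
    it, namely its first edge; this recovers the start. *)
Lemma cycle_arc_inj x y m m' : (0 < m < n)%N -> (0 < m' < n)%N ->
  cycle_arc x m = cycle_arc y m' -> x = y /\ m = m'.
Proof.
move=> /andP[m0 mn] /andP[m'0 m'n] E.
have xy : x = y.
  apply/eqP; rewrite eq_sym -subr_eq0; apply/negPn/negP => ne.
  have : cycle_edge y \in cycle_arc x m.
    by rewrite E mem_cycle_arc ?(ltnW m'n) // subrr.
  have : cycle_edge (y - 1) \notin cycle_arc x m.
    rewrite E mem_cycle_arc ?(ltnW m'n) // addrAC addrN add0r -leqNgt /=.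
    by rewrite !modn_small; lia.
  rewrite !mem_cycle_arc ?(ltnW mn) // addrAC.
  move: (y - x) ne => z ne.
  have z0 : (0 < z)%N by rewrite lt0n.
  have -> : (z - 1 : V) = z.-1 :> nat.
    rewrite -[z in LHS]natr_Zp -(natrB _ z0) val_ord_natr subn1 modn_small //.
    exact: leq_ltn_trans (leq_pred _) (ltn_ord z).
  by lia.
split=> //; subst y.
(* With a common start, the edges at offsets [m] and [m'] rule out both m < m' and m' < m. *)
have mem k k' : (k < n)%N -> (k' < n)%N ->
    cycle_edge (x + k'%:R) \in cycle_arc x k = (k' < k)%N.
  move=> kn k'n; rewrite mem_cycle_arc ?(ltnW kn) //.
  by rewrite addrAC addrN add0r val_ord_natr modn_small.
have := mem m m' mn m'n; have := mem m m mn mn.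
rewrite {1 2}E !mem // ltnn; lia.
Qed.


(** * Geodesic Leech labelings as periodic sequences *)

Lemma t_gp_cycle : t_gp Cn = (n * n./2)%N.
Proof.
rewrite /t_gp geodesic_pathsE card_imset ?card_prod ?card_ord //.
have jn (j : 'I_(n./2)) : (0 < j.+1 < n)%N by have := ltn_ord j; lia.
move=> [i j] [i' j'] /= /cycle_arc_inj[||-> [/val_inj->]] //; exact: jn.
Qed.

Lemma edges_cycle : edges Cn = [set cycle_edge x | x : V].
Proof.
apply/setP => e; apply/imsetP/imsetP => [[[x y] xy ->]|[x _ ->]].
  move: xy; rewrite inE /= cycle_adjE => /orP[] /eqP->; first by exists x.
  by exists y; rewrite // setUC.
by exists (x, x + 1); rewrite // inE /= cycle_adjE eqxx.
Qed.

Lemma path_weight_cycle_arc (f : {set V} -> nat) x m : (m <= n)%N ->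
  path_weight (G := Cn) f (cycle_arc x m) =
  arc_weight (fun t => f (cycle_edge t%:R)) x m.
Proof.
move=> mn; rewrite /arc_weight sumnE /path_weight /cycle_arc.
transitivity (\sum_(e <- [seq cycle_edge (x + t%:R)%R | t <- iota 0 m]) f e)%N.
  rewrite big_uniq; first by apply: eq_bigl => e; rewrite inE.
  rewrite map_inj_in_uniq ?iota_uniq // => t t'.
  rewrite !mem_iota !leq0n !add0n !andTb => tm t'm /cycle_edge_inj/addrI.
  by apply: mulrn_direction_inj;
    rewrite ?(leq_trans tm) ?(leq_trans t'm) // /direction eqxx.
have -> : iota x m = [seq (x + t)%N | t <- iota 0 m] by rewrite -iotaDl addn0.
rewrite !big_map.
by apply: eq_bigr => t _; rewrite natrD natr_Zp.
Qed.

Lemma geodesic_weightsP (f : {set V} -> nat) w :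
  (exists2 P, P \in geodesic_paths Cn & path_weight (G := Cn) f P = w) <->
  w \in arc_weights n (fun t => f (cycle_edge t%:R)).
Proof.
have jn (j : 'I_(n./2)) : (j.+1 <= n)%N by have := ltn_ord j; lia.
rewrite geodesic_pathsE; split=> [[_ /imsetP[[i j] _ ->] <-]|/allpairsP[[i j]]].
  rewrite path_weight_cycle_arc ?jn //.
  by apply/allpairsP; exists (val i, val j);
    rewrite !mem_iota !leq0n !add0n !andTb !ltn_ord.
rewrite !mem_iota !leq0n !add0n !andTb => -[iN jk ->].
exists (cycle_arc (Ordinal iN) (Ordinal jk).+1).
  by apply/imsetP; exists (Ordinal iN, Ordinal jk).
by rewrite path_weight_cycle_arc ?jn.
Qed.

(** The list has n * k entries, so covering n * k values leaves no room for a repetition. *)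
Lemma perm_arc_weights c :
  (forall w, w \in arc_weights n c <-> (1 <= w <= n * n./2)%N) <->
  perm_eq (arc_weights n c) (iota 1 (n * n./2)).
Proof.
have memE w : (w \in iota 1 (n * n./2)) = (1 <= w <= n * n./2)%N.
  by rewrite mem_iota add1n ltnS.
split=> [H|/perm_mem H w]; last by rewrite H memE.
have eqm : iota 1 (n * n./2) =i arc_weights n c.
  by move=> w; rewrite memE; apply/idP/idP => /H.
have sz : size (arc_weights n c) = size (iota 1 (n * n./2)).
  by rewrite size_allpairs !size_iota.
apply: uniq_perm; rewrite ?iota_uniq //.
rewrite (@uniq_size_uniq _ (iota 1 (n * n./2))) ?iota_uniq ?sz //.
Qed.

Lemma cycle_leechP :
  geodesic_leech_graph Cn <-> exists c, cyclic_leech n c.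
Proof.
split=> [[f [f0 fw]]|[c [cn c0 cw]]].
  exists (fun t => f (cycle_edge t%:R)); split=> [t|t|].
  - by congr (f (cycle_edge _)); apply: val_inj; rewrite /= !val_ord_natr modn_mod.
  - by apply: f0; rewrite edges_cycle imset_f.
  by apply/perm_arc_weights => w; rewrite -t_gp_cycle -fw geodesic_weightsP.
(* The starting vertex of an edge is unique by [cycle_edge_inj], so the picked label is the right
   one; a set that is not an edge gets the default 1. *)
exists (fun e : {set Cn} =>
  if [pick x : V | cycle_edge x == e] is Some x then c x else 1).
set f := fun e => _.
have fE x : f (cycle_edge x) = c x.
  rewrite /f; case: pickP => [y /eqP/cycle_edge_inj->//|/(_ x)].
  by rewrite eqxx.
split=> [e|w]; first by rewrite edges_cycle => /imsetP[x _ ->]; rewrite fE.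
rewrite geodesic_weightsP t_gp_cycle.
suff -> : arc_weights n (fun t => f (cycle_edge t%:R)) = arc_weights n c.
  exact: (proj2 (perm_arc_weights c)).
congr flatten; apply: eq_map => i; apply: eq_map => j.
by apply: (@eq_arc_weight _ c i j.+1) => t; rewrite fE val_ord_natr.
Qed.

End CycleGeodesics.

Theorem theorem2p5 :
  geodesic_leech_graph (cycle_graph 3) /\
  geodesic_leech_graph (cycle_graph 4) /\
  (forall n : nat, 5 <= n -> ~ geodesic_leech_graph (cycle_graph n)).
Proof.
(* For n = 3 the geodesics are the single edges, so the labels are the weights. *)
split; first by apply/cycle_leechP; exists (fun t => nth 0 [:: 1; 2; 3] (t %% 3));
  split=> // t;
  [rewrite modn_mod | case: (t %% 3) (ltn_pmod t (isT : 0 < 3)) => [|[|[|]]]].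
(* The two-edge arcs weigh 4, 5, 8 and 7, which completes the labels 1, 3, 2, 6 to the values 1 to
   8. *)
split; first by apply/cycle_leechP; exists (fun t => nth 0 [:: 1; 3; 2; 6] (t %% 4));
  split=> // t;
  [rewrite modn_mod | case: (t %% 4) (ltn_pmod t (isT : 0 < 4)) => [|[|[|[|]]]]].
move=> [|[|[|n]]] // n5 /cycle_leechP[c lc].
have nE := cyclic_leech_order n5 lc.
by apply: (@no_cyclic_leech10 c); rewrite -nE.
Qed.
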